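(* Let $\mathcal{X}\subseteq\mathbb{R}^n$ and $\mathcal{Y}\subseteq\mathbb{R}^m$ be nonempty convex compact sets, let $f:\mathcal{X}\times\mathcal{Y}\to\mathbb{R}$ be smooth (possibly nonconvex in $x$), let $h:\mathbb{R}^n\to\mathbb{R}$ and $g:\mathbb{R}^m\to\mathbb{R}$ be proper convex continuous (possibly nonsmooth) functions, and let $A\in\mathbb{R}^{p\times n}$, $B\in\mathbb{R}^{p\times m}$, $c\in\mathbb{R}^p$. Suppose $f(x,y)$ is concave with respect to $y$. Put $\mathcal{L}(x,y,\lambda)=f(x,y)-\lambda^\top(Ax+By-c)$ for $\lambda\in\mathbb{R}^p$. Then strong duality with respect to $y$ holds: $$\min_{x\in\mathcal{X}}\ \max_{\substack{y\in\mathcal{Y}\\ Ax+By=c}}\{f(x,y)+h(x)-g(y)\}=\min_{\lambda\in\mathbb{R}^p}\ \min_{x\in\mathcal{X}}\ \max_{y\in\mathcal{Y}}\{\mathcal{L}(x,y,\lambda)+h(x)-g(y)\},$$ and a point $(x^*,y^* )$ is a stationary point of the constrained minimax problem on the left-hand side if and only if there exists $\lambda^*\in\mathbb{R}^p$ such that $(x^*,y^*,\lambda^* )$ is a stationary point of the dual problem on the right-hand side.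
   Context: In the displayed identity, $\min$ and $\max$ denote infimum and supremum in the extended reals, with the maximum over an empty set equal to $-\infty$. For a proper convex function $q$, a convex compact set $\mathcal{Z}$ and $\alpha>0$, the proximity operator is $\operatorname{Prox}_{q,\mathcal{Z}}^{\alpha}(\upsilon):=\arg\min_{z\in\mathcal{Z}}\{q(z)+\frac{\alpha}{2}\|z-\upsilon\|^2\}$. Stationarity: for given $\alpha,\beta,\gamma>0$ let $$\nabla G^{\alpha,\beta,\gamma}(x,y,\lambda):=\begin{pmatrix}\alpha\left(x-\operatorname{Prox}_{h,\mathcal{X}}^{\alpha}\left(x-\frac1\alpha\nabla_x\mathcal{L}(x,y,\lambda)\right)\right)\\ \beta\left(y-\operatorname{Prox}_{g,\mathcal{Y}}^{\beta}\left(y+\frac1\beta\nabla_y\mathcal{L}(x,y,\lambda)\right)\right)\\ \nabla_\lambda\mathcal{L}(x,y,\lambda)\end{pmatrix}.$$ A point $(x,y)\in\mathcal{X}\times\mathcal{Y}$ is a stationary point of the constrained problem $\min_{x\in\mathcal{X}}\max_{y\in\mathcal{Y},\,Ax+By=c}\{f(x,y)+h(x)-g(y)\}$ if there exists $\lambda\in\mathbb{R}^p$ with $\nabla G^{\alpha,\beta,\gamma}(x,y,\lambda)=0$. A point $(x,y,\lambda)\in\mathcal{X}\times\mathcal{Y}\times\mathbb{R}^p$ is a stationary point of the dual problem $\min_{\lambda}\min_{x\in\mathcal{X}}\max_{y\in\mathcal{Y}}\{\mathcal{L}(x,y,\lambda)+h(x)-g(y)\}$ if $\nabla G^{\alpha,\beta,\gamma}(x,y,\lambda)=0$.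 *)

(* Defs.v *)
(* R^n is encoded as the column vectors 'cV[R]_n. *)
From HB Require Import structures.
From mathcomp Require Import all_boot all_order all_algebra.
From mathcomp Require Import all_classical all_reals all_analysis.

Set Implicit Arguments.
Unset Strict Implicit.
Unset Printing Implicit Defensive.

Import Order.TTheory GRing.Theory Num.Theory.
Import numFieldNormedType.Exports.

Local Open Scope classical_set_scope.
Local Open Scope convex_scope.
Local Open Scope ring_scope.

Definition concave_function (R : numFieldType) (E : lmodType R)
    (E' := convex_lmodType E) (D : set E') (f : E' -> R^o) : Prop :=
  forall t : {i01 R},
    {in D &, forall x y : E', (f x <| t |> f y <= f (x <| t |> y))%R}.

(* [smooth_on D F]: F is continuously differentiable on some open neighbourhood
   of D, so that gradients make sense at boundary points of D; the values of F
   away from D are otherwise unconstrained. *)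
Definition smooth_on (R : realType) (V : normedModType R)
    (D : set V) (F : V -> R) : Prop :=
  exists U : set V,
    [/\ open U, D `<=` U,
        forall z, U z -> differentiable F z &
        forall v z, U z -> {for z, continuous (fun w => 'D_v F w)}].

Section problem.
Context {R : realType}.

(* The library norm on matrices is the sup norm, whence this definition. *)
Definition sq_euclidean_norm n (v : 'cV[R]_n) : R := \sum_(i < n) v i 0 ^+ 2.

Definition gradient n (F : 'cV[R]_n -> R) (x : 'cV[R]_n) : 'cV[R]_n :=
  \col_(i < n) 'D_(delta_mx i 0) F x.

Definition argmin (T : Type) (Z : set T) (F : T -> R) : set T :=
  [set z | Z z /\ forall w, Z w -> F z <= F w].

(* The argmin is a singleton when Z is nonempty, convex and compact, q is
   convex and continuous, and alpha > 0; [get] returns its element. *)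
Definition prox n (alpha : R) (q : 'cV[R]_n -> R) (Z : set 'cV[R]_n)
    (v : 'cV[R]_n) : 'cV[R]_n :=
  get (argmin Z (fun z => q z + alpha / 2 * sq_euclidean_norm (z - v))).

Context {n m p : nat}.
Variables (X : set 'cV[R]_n) (Y : set 'cV[R]_m).
Variables (f : 'cV[R]_n -> 'cV[R]_m -> R).
Variables (h : 'cV[R]_n -> R) (g : 'cV[R]_m -> R).
Variables (A : 'M[R]_(p, n)) (B : 'M[R]_(p, m)) (c : 'cV[R]_p).

Definition lagrangian (x : 'cV[R]_n) (y : 'cV[R]_m) (lam : 'cV[R]_p) : R :=
  f x y - (lam^T *m (A *m x + B *m y - c)) 0 0.

(* gamma does not occur in the formula; it is kept because stationarity is
   defined relative to a triple (alpha, beta, gamma). *)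
Definition gradG (alpha beta gamma : R)
    (x : 'cV[R]_n) (y : 'cV[R]_m) (lam : 'cV[R]_p) : 'cV[R]_(n + (m + p)) :=
  let gx := gradient (fun u => lagrangian u y lam) x in
  let gy := gradient (fun v => lagrangian x v lam) y in
  let gl := gradient (fun l => lagrangian x y l) lam in
  col_mx (alpha *: (x - prox alpha h X (x - alpha^-1 *: gx)))
    (col_mx (beta *: (y - prox beta g Y (y + beta^-1 *: gy)))
       gl).

Definition stationary_constrained (alpha beta gamma : R)
    (x : 'cV[R]_n) (y : 'cV[R]_m) : Prop :=
  [/\ X x, Y y & exists lam : 'cV[R]_p, gradG alpha beta gamma x y lam = 0].

Definition stationary_dual (alpha beta gamma : R)
    (x : 'cV[R]_n) (y : 'cV[R]_m) (lam : 'cV[R]_p) : Prop :=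
  [/\ X x, Y y & gradG alpha beta gamma x y lam = 0].

Definition constrained_value : \bar R :=
  ereal_inf [set ereal_sup [set (f x y + h x - g y)%:E
                           | y in [set y | Y y /\ A *m x + B *m y = c]]
            | x in X].

Definition dual_value : \bar R :=
  ereal_inf [set ereal_inf [set ereal_sup [set (lagrangian x y lam + h x - g y)%:E
                                          | y in Y]
                           | x in X]
            | lam in [set: 'cV[R]_p]].

End problem.

(* Main.v *)
(* The equivalence of stationary points is immediate from the definitions. For
   the values, the two infima on the dual side commute, so it suffices to show,
   for each x, that maximizing the concave phi over the y in Y with M y = d has
   no duality gap. No constraint qualification is needed because Y is compact.
   Let r exceed the constrained supremum and let y0 minimize
   |M y - d|^2 + max(r - phi y, 0)^2 over Y. The minimum is positive; with
   u = M y0 - d and w = max(r - phi y0, 0), first-order optimality reads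
   <u, M y - d> + w (r - phi y) >= |u|^2 + w^2 > 0 on Y. If w > 0, then u / w is
   a multiplier certifying the bound r; if w = 0, then a large multiple of u
   is. *)
Require Import Defs.
From HB Require Import structures.
From mathcomp Require Import all_boot all_order all_algebra.
From mathcomp Require Import all_classical all_reals all_analysis.
From mathcomp Require Import ring lra.

Set Implicit Arguments.
Unset Strict Implicit.
Unset Printing Implicit Defensive.

Import Order.TTheory GRing.Theory Num.Theory.
Import numFieldNormedType.Exports.

Local Open Scope classical_set_scope.
Local Open Scope ring_scope.

Section euclidean.
Context {R : realType}.

Lemma sq_euclidean_norm_ge0 n (v : 'cV[R]_n) : 0 <= sq_euclidean_norm v.
Proof. by apply: sumr_ge0 => i _; exact: sqr_ge0. Qed.

Lemma sq_euclidean_norm_eq0 n (v : 'cV[R]_n) :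
  (sq_euclidean_norm v == 0) = (v == 0).
Proof.
apply/eqP/eqP => [v0|->]; last first.
  by rewrite /sq_euclidean_norm big1// => i _; rewrite mxE expr0n.
apply/colP => i; rewrite mxE; apply/eqP; rewrite -sqrf_eq0.
by rewrite (psumr_eq0P _ v0)// => j _; exact: sqr_ge0.
Qed.

Lemma sq_euclidean_normE n (v : 'cV[R]_n) :
  sq_euclidean_norm v = (v^T *m v) 0 0.
Proof. by rewrite mxE; apply: eq_bigr => i _; rewrite mxE expr2. Qed.

Lemma sq_euclidean_normDZ n (u v : 'cV[R]_n) t :
  sq_euclidean_norm (u + t *: v) =
  sq_euclidean_norm u + 2 * t * (u^T *m v) 0 0 + t ^+ 2 * sq_euclidean_norm v.
Proof.
rewrite /sq_euclidean_norm mxE !mulr_sumr -!big_split/=.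
by apply: eq_bigr => i _; rewrite !mxE; ring.
Qed.

Lemma continuous_sum (T : topologicalType) n (F : 'I_n -> T -> R) :
  (forall i, continuous (F i)) -> continuous (fun x => \sum_(i < n) F i x).
Proof. by move=> cF x; apply: (cvg_big add_continuous) => i _; exact: cF. Qed.

Lemma continuous_residual_norm m n (M : 'M[R]_(m, n)) (d : 'cV[R]_m) :
  continuous (fun v : 'cV[R]_n => sq_euclidean_norm (M *m v - d)).
Proof.
apply: continuous_sum => i v.
apply: (@continuous_comp _ _ _ (fun v => (M *m v - d) i 0) (fun x => x ^+ 2));
  last exact: exprn_continuous.
have -> : (fun v => (M *m v - d) i 0) = fun v => \sum_j M i j * v j 0 - d i 0.
  by apply/funext => w; rewrite !mxE.
apply: continuousB; last exact: cst_continuous.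
apply: continuous_sum => j w; apply: continuousM; first exact: cst_continuous.
exact: coord_continuous.
Qed.

Lemma continuous_penalty (T : topologicalType) (a b : T -> R) (r : R) x :
  {for x, continuous a} -> {for x, continuous b} ->
  {for x, continuous (fun y => a y + Num.max (r - b y) 0 ^+ 2)}.
Proof.
move=> ca cb; apply: cvgD; first exact: ca.
apply: (@continuous_comp _ _ _ (fun y => Num.max (r - b y) 0)
  (fun x => x ^+ 2)); last exact: exprn_continuous.
apply: (@continuous_max _ _ (fun y => r - b y) (fun=> 0)).
  by apply: cvgB; [exact: cvg_cst|exact: cb].
exact: cst_continuous.
Qed.

(** Divide by [t] and let [t] tend to 0: the quadratic term cannot offset a negative slope. *)
Lemma first_order_ge0 (a b : R) :
  (forall t, 0 <= t <= 1 -> 0 <= 2 * t * a + t ^+ 2 * b) -> 0 <= a.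
Proof.
move=> H; rewrite leNgt; apply/negP => a0.
have d0 : 0 < `|b| - a by rewrite ltr_wpDl// oppr_gt0.
(* For [a < 0] this [t] lies in (0, 1] and [t * b <= - a + t * a < - a], so [2 * a + t * b < a < 0],
   a contradiction. *)
pose t := - a / (`|b| - a).
have t0 : 0 < t by rewrite divr_gt0// oppr_gt0.
have t1 : t <= 1 by rewrite ler_pdivrMr// mul1r lerDr.
have tE : t * (`|b| - a) = - a by rewrite mulfVK// gt_eqF.
have : 0 <= 2 * a + t * b.
  rewrite -(pmulr_rge0 _ t0).
  have := H t; rewrite (ltW t0) t1 => /(_ isT).
  by congr (0 <= _); ring.
have := ler_norm b; nra.
Qed.

End euclidean.

Section duality.
Context {R : realType} {m p : nat}.
Variables (Y : set 'cV[R]_m) (phi : 'cV[R]_m -> R).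
Variables (M : 'M[R]_(p, m)) (d : 'cV[R]_p).
Hypotheses (Y_nonempty : Y !=set0) (Y_compact : compact Y).
Hypothesis Y_convex : @convex_set R 'cV[R]_m Y.
Hypothesis phi_concave : @concave_function R 'cV[R]_m Y phi.
Hypothesis phi_cont : {in Y, continuous phi}.

(** If no point of [Y] is feasible, the hypothesis is vacuous and every real [r] admits a
    multiplier; this settles the case of value -oo. *)
Lemma lagrange_multiplier (r : R) :
  (forall y, Y y -> M *m y = d -> phi y < r) ->
  exists lam : 'cV[R]_p,
    forall y, Y y -> phi y - (lam^T *m (M *m y - d)) 0 0 <= r.
Proof.
move=> phi_lt_r.
pose res y := M *m y - d.
pose F y := sq_euclidean_norm (res y) + Num.max (r - phi y) 0 ^+ 2.
have F_cont : {within Y, continuous F}.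
  apply: continuous_in_subspaceT => y Yy.
  have res_cont : continuous (fun y => sq_euclidean_norm (res y)).
    exact: continuous_residual_norm.
  apply: (continuous_penalty (a := fun y => sq_euclidean_norm (res y))).
    exact: res_cont.
  exact: phi_cont.
have [y0 /set_mem Yy0 F_min] := compact_EVT_min Y_nonempty Y_compact F_cont.
(* The maximum of [phi] over all of [Y] sizes the multiplier when [w = 0]. *)
have [y1 _ phi_max] := compact_EVT_max Y_nonempty Y_compact
  (continuous_in_subspaceT phi_cont).
set u := res y0; set w := Num.max (r - phi y0) 0.
have w_ge0 : 0 <= w by rewrite le_max lexx orbT.
(* If [u = 0] then [y0] is feasible, so [phi y0 < r] and [w > 0]. *)
have F_gt0 : 0 < sq_euclidean_norm u + w ^+ 2.
  have [u0|u_neq0] := eqVneq u 0.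
    rewrite ltr_wpDl ?sq_euclidean_norm_ge0// exprn_gt0// lt_max subr_gt0.
    by rewrite phi_lt_r//; apply/eqP; rewrite -subr_eq0 -/(res y0) -/u u0.
  rewrite ltr_pwDl ?sqr_ge0// lt_neqAle sq_euclidean_norm_ge0 andbT eq_sym.
  by rewrite sq_euclidean_norm_eq0.
have opt y : Y y -> sq_euclidean_norm u + w ^+ 2 <=
    (u^T *m res y) 0 0 + w * (r - phi y).
  move=> Yy; set b := r - phi y.
  have dotB : (u^T *m (res y - u)) 0 0 =
      (u^T *m res y) 0 0 - sq_euclidean_norm u.
    by rewrite mulmxBr sq_euclidean_normE !mxE.
  (* The goal becomes nonnegativity of half the slope at [t = 0] of a quadratic bound for [F] on the
     segment from [y0] to [y]. *)
  have -> : forall a, a + w * b = sq_euclidean_norm u + w ^+ 2 +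
      (a - sq_euclidean_norm u + w * (b - w)).
    by move=> a; ring.
  rewrite lerDl -dotB.
  apply: (first_order_ge0 (b := sq_euclidean_norm (res y - u) + (b - w) ^+ 2)).
  move=> t /andP[t0 t1].
  have := phi_concave (Itv01 t0 t1) (mem_set Yy) (mem_set Yy0).
  have := Y_convex (Itv01 t0 t1) (mem_set Yy) (mem_set Yy0).
  set yt := conv _ _ _ => Yyt; rewrite convRE /= /unstable.onem => phi_yt.
  have res_yt : res yt = u + t *: (res y - u).
    rewrite /u /res /yt /conv/= /unstable.onem mulmxDr -!scalemxAr.
    by move: (M *m y) (M *m y0) => a b'; apply/colP => i; rewrite !mxE; ring.
  have := F_min _ Yyt; rewrite /F -/u -/w res_yt sq_euclidean_normDZ.
  (* By concavity the penalty term lies below the square of an affine function of [t], with equality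
     at [t = 0], so minimality of [y0] passes to a quadratic in [t]. *)
  have : Num.max (r - phi yt) 0 ^+ 2 <= (w + t * (b - w)) ^+ 2.
    have w_ge : r - phi y0 <= w by rewrite le_max lexx.
    have -> : w + t * (b - w) = t * b + (1 - t) * w by ring.
    case: (leP (r - phi yt) 0) => [_|pos].
      by rewrite expr0n sqr_ge0.
    rewrite ler_sqr ?nnegrE ?(ltW pos)//; rewrite /b in phi_yt *; nra.
  rewrite /= ; lra.
have dotZ k y : ((k *: u)^T *m (M *m y - d)) 0 0 = k * (u^T *m res y) 0 0.
  by rewrite linearZ/= -scalemxAl mxE.
have [w0|w_neq0] := eqVneq w 0.
  move: F_gt0 opt; rewrite w0 expr0n addr0 => u_gt0 opt.
  (* Now [opt] bounds the pairing of [u] with the residual below by the squared norm of [u]; scaled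
     by [k], this exceeds [phi y1 - r], hence [phi y - r] on [Y]. *)
  pose k := `|phi y1 - r| / sq_euclidean_norm u.
  exists (k *: u) => y Yy; rewrite dotZ.
  have : k * sq_euclidean_norm u <= k * (u^T *m res y) 0 0.
    rewrite ler_wpM2l ?divr_ge0 ?(ltW u_gt0)//.
    by have := opt _ Yy; rewrite mul0r addr0.
  rewrite mulfVK ?gt_eqF// => le_k.
  have := ler_norm (phi y1 - r); have := phi_max _ (mem_set Yy); lra.
have w_gt0 : 0 < w by rewrite lt_neqAle eq_sym w_neq0.
exists (w^-1 *: u) => y Yy; rewrite dotZ -subr_ge0 -(pmulr_rge0 _ w_gt0).
have := le_trans (ltW F_gt0) (opt _ Yy).
by congr (0 <= _); field.
Qed.

Lemma strong_duality :
  ereal_sup [set (phi y)%:E | y in [set y | Y y /\ M *m y = d]] =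
  ereal_inf [set ereal_sup [set (phi y - (lam^T *m (M *m y - d)) 0 0)%:E
                           | y in Y] | lam in [set: 'cV[R]_p]].
Proof.
apply/eqP; rewrite eq_le; apply/andP; split.
  (* Weak duality: the multiplier term vanishes at feasible points. *)
  apply: ge_ereal_sup => _ [y [Yy Myd] <-].
  apply: le_ereal_inf_tmp => _ [lam _ <-].
  apply: ereal_sup_ubound; exists y => //.
  by rewrite Myd subrr mulmx0 mxE subr0.
set V := ereal_sup _; set D := ereal_inf _.
have D_le (r : R) : (V < r%:E)%E -> (D <= r%:E)%E.
  move=> Vr; have [y Yy Myd|lam phi_le] := lagrange_multiplier (r := r).
    rewrite -lte_fin; apply: le_lt_trans Vr.
    by apply: ereal_sup_ubound; exists y.
  apply: ge_ereal_inf; exists (ereal_sup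
      [set (phi y - (lam^T *m (M *m y - d)) 0 0)%:E | y in Y]).
    by exists lam.
  by apply: ge_ereal_sup => _ [y Yy <-]; rewrite lee_fin phi_le.
(* A finite [V] is approached by [v + e]; if [V] is -oo, then [D] lies below every real. *)
case: V D_le => [v| |] D_le; [|exact: leey|].
- by apply/lee_addgt0Pr => e e0; apply: D_le; rewrite lte_fin ltrDl.
- by rewrite leeNy_eq; apply/eqP/eq_ninfty => r; apply: D_le; exact: ltNyr.
Qed.

End duality.

Lemma continuous_pair (T U : topologicalType) (x : T) :
  continuous (fun y : U => (x, y)).
Proof. by move=> y; apply: cvg_pair => /=; [exact: cvg_cst|exact: cvg_id]. Qed.

Theorem theorem1 (R : realType) (n m p : nat)
    (X : set 'cV[R]_n) (Y : set 'cV[R]_m)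
    (f : 'cV[R]_n -> 'cV[R]_m -> R)
    (h : 'cV[R]_n -> R) (g : 'cV[R]_m -> R)
    (A : 'M[R]_(p, n)) (B : 'M[R]_(p, m)) (c : 'cV[R]_p)
    (X_nonempty : X !=set0) (X_convex : @convex_set R 'cV[R]_n X)
    (X_compact : compact X)
    (Y_nonempty : Y !=set0) (Y_convex : @convex_set R 'cV[R]_m Y)
    (Y_compact : compact Y)
    (f_smooth : smooth_on (X `*` Y) (fun z : 'cV[R]_n * 'cV[R]_m => f z.1 z.2))
    (h_convex : @convex_function R 'cV[R]_n setT h) (h_cont : continuous h)
    (g_convex : @convex_function R 'cV[R]_m setT g) (g_cont : continuous g)
    (f_concave : forall x, X x -> @concave_function R 'cV[R]_m Y (f x)) :
  constrained_value X Y f h g A B c = dual_value X Y f h g A B c /\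
  (forall alpha beta gamma : R, 0 < alpha -> 0 < beta -> 0 < gamma ->
   forall (x : 'cV[R]_n) (y : 'cV[R]_m),
     stationary_constrained X Y f h g A B c alpha beta gamma x y <->
     exists lam : 'cV[R]_p,
       stationary_dual X Y f h g A B c alpha beta gamma x y lam).
Proof.
split; last first.
  move=> alpha beta gamma _ _ _ x y.
  split=> [[Xx Yy [lam G0]]|[lam [Xx Yy G0]]]; first by exists lam.
  by split=> //; exists lam.
have duality x : X x ->
    ereal_sup [set (f x y + h x - g y)%:E
              | y in [set y | Y y /\ A *m x + B *m y = c]] =
    ereal_inf [set ereal_sup [set (lagrangian f A B c x y lam + h x - g y)%:E
                             | y in Y] | lam in [set: 'cV[R]_p]].
  move=> Xx.
  (* With [x] fixed, [A *m x] moves into the right-hand side, giving the constraint form of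
     [strong_duality]. *)
  have -> : [set y | Y y /\ A *m x + B *m y = c] =
      [set y | Y y /\ B *m y = c - A *m x].
    apply/seteqP; split=> y [Yy yE]; split=> //.
      by rewrite -yE addrC addKr.
    by rewrite yE addrC subrK.
  rewrite (@strong_duality _ _ _ Y (fun y => f x y + h x - g y)) //.
  - congr ereal_inf; apply: eq_imagel => lam _.
    congr ereal_sup; apply: eq_imagel => y _.
    by congr (_%:E); rewrite /lagrangian opprB addrA [B *m y + _]addrC; ring.
  - move=> t y z Yy Yz.
    have := f_concave _ Xx t y z Yy Yz.
    have := g_convex t y z (mem_set I) (mem_set I).
    rewrite !convRE /= /unstable.onem. lra.
  - move=> y /set_mem Yy.
    have [U [_ XYU f_diff _]] := f_smooth.
    (* Joint differentiability at [(x, y)] gives continuity of the slice [f x] at [y]. *)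
    have f_cont :=
      differentiable_continuous (f_diff (x, y) (XYU (x, y) (conj Xx Yy))).
    apply: (@continuousB R R _ (fun y => f x y + h x) g y); last exact: g_cont.
    apply: (@continuousD R R _ (f x) (fun=> h x) y); last exact: cst_continuous.
    exact: (continuous_comp (@continuous_pair _ _ x y) f_cont).
(* Both sides are infima over pairs of [x] and [lam], taken in opposite orders. *)
apply/eqP; rewrite eq_le; apply/andP; split.
  apply: le_ereal_inf_tmp => _ [lam _ <-].
  apply: le_ereal_inf_tmp => _ [x Xx <-].
  apply: ge_ereal_inf; eexists; first by exists x.
  by rewrite duality//; apply: ereal_inf_lbound; exists lam.
apply: le_ereal_inf_tmp => _ [x Xx <-]; rewrite duality//.
apply: le_ereal_inf_tmp => _ [lam _ <-].
apply: ge_ereal_inf; eexists; first by exists lam.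
by apply: ereal_inf_lbound; exists x.
Qed.
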